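(* Suppose that there is a family $\{\Lambda_A:A>0\}$ of countable subsets of $\mathbb{R}$, each enumerated in strictly increasing order by $\mathbb{Z}$, such that for every $A>0$ $$\sum_{\lambda\in\Lambda_A}\Big|\int_{[0,1]}f(x)e^{-2\pi i\lambda x}\,dx\Big|^2\ge A\int_{[0,1]}|f(x)|^2\,dx\qquad\text{for all } f\in L^2([0,1]).$$ Then $$\limsup_{A\to\infty}A\,g_{\min}(\Lambda_A)\le 1.$$
   Context: For a set $\Lambda=\{\lambda_k\}_{k\in\mathbb{Z}}\subset\mathbb{R}$ with $\lambda_n<\lambda_m$ whenever $n<m$, the spectral gaps are $g_k(\Lambda):=\lambda_k-\lambda_{k-1}$, $k\in\mathbb{Z}$. The essential minimal spectral gap is $$g_{\min}(\Lambda):=\inf\{c\ge 0: g_k(\Lambda)<c\text{ for infinitely many }k\}.$$ *)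

(* Defs.v *)
From HB Require Import structures.
From mathcomp Require Import all_boot all_order all_algebra.
From mathcomp Require Import all_classical all_reals all_analysis.
From mathcomp Require Import complex.
Set Implicit Arguments.
Unset Strict Implicit.
Unset Printing Implicit Defensive.
Import Order.TTheory GRing.Theory Num.Theory.
Import numFieldNormedType.Exports.
Local Open Scope classical_set_scope.
Local Open Scope ring_scope.
Local Open Scope complex_scope.

Definition cexp (R : realType) (z : R[i]) : R[i] :=
  (expR (complex.Re z))%:C * (cos (complex.Im z) +i* sin (complex.Im z)).

(* Integral over [0,1] of a complex-valued function; it is meaningful when the
   real and imaginary parts are integrable. *)
Definition cint01 (R : realType) (f : R -> R[i]) : R[i] :=
  Rintegral (@lebesgue_measure R) `[0, 1] (fun x => complex.Re (f x)) +i*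
  Rintegral (@lebesgue_measure R) `[0, 1] (fun x => complex.Im (f x)).

Definition sqnorm01 (R : realType) (f : R -> R[i]) : \bar R :=
  (\int[@lebesgue_measure R]_(x in `[0%R, 1%R]) ((Normc.normc (f x)) ^+ 2)%:E)%E.

(* Measurability is with respect to the Borel sigma-algebra, on which
   [lebesgue_measure] is defined; every class of L^2([0,1]) has a Borel
   representative. *)
Definition inL2_01 (R : realType) (f : R -> R[i]) : Prop :=
  [/\ measurable_fun (`[0, 1]%classic : set R) (fun x : R => complex.Re (f x)),
      measurable_fun (`[0, 1]%classic : set R) (fun x : R => complex.Im (f x)) &
      (sqnorm01 f < +oo)%E].

Definition fourier01 (R : realType) (f : R -> R[i]) (l : R) : R[i] :=
  cint01 (fun x => f x * cexp ((- (2 * pi * l * x)) *i)).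

Definition increasing_enumeration (R : realType) (lam : int -> R)
    (L : set R) : Prop :=
  {homo lam : n m / n < m} /\ range lam = L.

Definition gap (R : realType) (lam : int -> R) (k : int) : R :=
  lam k - lam (k - 1).

(* An increasing enumeration of a set by the integers is unique up to a shift
   of the index, so the value depends only on the range of [lam].
   The infimum of the empty set is +oo. *)
Definition gmin (R : realType) (lam : int -> R) : \bar R :=
  ereal_inf [set c%:E | c in
    [set c : R | 0 <= c /\ infinite_set [set k | gap lam k < c]]].

(* Main.v *)
(* The lower frame inequality forces A * gmin <= 1 for every A > 0. Suppose that
   all but finitely many gaps are at least c, and test the inequality with the
   exponentials e^(2 pi i k x), 0 <= k < N, whose transform at x has square
   modulus sinc^2(pi (k - x)). Summing over k gives
     N A <= sum_(x in Lambda) S(x),  S(x) = sum_(k < N) sinc^2(pi (k - x)).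
   By Bessel S <= 1, and S(x) <= N / d^2 at distance d from [0, N]. As Lambda is
   c-spaced up to finitely many points, [- l, N + l] contains at most
   (N + 2 l) / c + O(1) of its points, and the others contribute
   O(N (1 / l^2 + 1 / (c l))). With N = l^2 and l going to infinity,
   A <= 1 / c. *)
Require Import Defs.
From HB Require Import structures.
From mathcomp Require Import all_boot all_order all_algebra.
From mathcomp Require Import all_classical all_reals all_analysis.
From mathcomp Require Import complex.
From mathcomp Require Import measurable_realfun finmap ring lra.
Set Implicit Arguments.
Unset Strict Implicit.
Unset Printing Implicit Defensive.
Import Order.TTheory GRing.Theory Num.Theory.
Import numFieldNormedType.Exports.
Local Open Scope classical_set_scope.
Local Open Scope ring_scope.

(** * Separated finite sets of reals: counting points and summing inverse squares *)

Section Spaced.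
Variable F : realFieldType.
Implicit Types (a b c x y : F) (s : seq F).

Definition spaced c s := {in s &, forall x y, x != y -> c <= `|x - y|}.

Lemma spaced_filter c s (p : pred F) :
  spaced c s -> spaced c [seq x <- s | p x].
Proof.
move=> sep x y; rewrite !mem_filter => /andP[_ xs] /andP[_ ys].
exact: sep.
Qed.

Lemma spaced_opp c s : spaced c s -> spaced c (map -%R s).
Proof.
move=> sep _ _ /mapP[x xs ->] /mapP[y ys ->] xy.
by rewrite -opprD normrN; apply: sep => //; rewrite -eqr_opp.
Qed.

(** Sorting turns the symmetric separation into an ordered one, which suits induction along the
    list. *)
Lemma spaced_sort c s : uniq s -> spaced c s ->
  pairwise (fun x y => x + c <= y) (sort <=%R s).
Proof.
move=> us sep.
have lts : pairwise <%R (sort <=%R s).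
  by rewrite -(sorted_pairwise lt_trans) sort_lt_sorted.
apply: (sub_in_pairwise (P := mem s)) lts => [x y xs ys xy|]; last first.
  by apply/allP => x; rewrite mem_sort.
have := sep _ _ ys xs.
rewrite gt_eqF// gtr0_norm ?subr_gt0// => /(_ isT).
lra.
Qed.

Lemma pairwise_size_le b c x s :
  pairwise (fun x y => x + c <= y) (x :: s) ->
  {in x :: s, forall y, y <= b} -> x + c * (size s)%:R <= b.
Proof.
elim: s x => [|y s IHs] x /=.
  by move=> _ /(_ x); rewrite mulr0 addr0 inE eqxx => ->.
move=> /andP[/andP[xy _] rys] le_b.
have le_b' : {in y :: s, forall z, z <= b}.
  by move=> z zs; apply: le_b; rewrite inE zs orbT.
have := IHs y rys le_b'; rewrite -natr1; lra.
Qed.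

(** After sorting, each step from the first point to the last costs at least [c]; the extra [c] pays
    for the first point. *)
Lemma spaced_size_le a b c s : uniq s -> 0 <= c -> a <= b ->
  spaced c s -> {in s, forall y, a <= y <= b} ->
  c * (size s)%:R <= b - a + c.
Proof.
move=> us c0 ab /(spaced_sort us) ps abs.
rewrite -(size_sort <=%R); have : {in sort <=%R s, forall y, a <= y <= b}.
  by move=> y; rewrite mem_sort; exact: abs.
case: (sort _ s) ps => [|x t] ps {}abs; first by rewrite mulr0; lra.
have /= := pairwise_size_le ps (fun y ys => proj2 (andP (abs y ys))).
have /andP[ax _] := abs x (mem_head _ _).
rewrite -natr1; lra.
Qed.

(* The sum telescopes: 1/y^2 <= 1/(xy) <= (1/x - 1/y)/c when x + c <= y. *)
Lemma pairwise_sum_inv_sqr_le c x s : 0 < c -> 0 < x ->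
  pairwise (fun x y => x + c <= y) (x :: s) ->
  \sum_(y <- s) (y ^+ 2)^-1 <= (c * x)^-1.
Proof.
move=> c0; elim: s x => [|y s IHs] x x0 /=.
  by rewrite big_nil invr_ge0 mulr_ge0// ltW.
move=> /andP[/andP[xy _] rys]; rewrite big_cons.
have y0 : 0 < y by lra.
apply: le_trans (lerD (lexx _) (IHs _ y0 rys)) _.
rewrite -subr_ge0.
have -> : (c * x)^-1 - ((y ^+ 2)^-1 + (c * y)^-1) =
    (y * (y - x - c) + c * (y - x)) / (c * x * y ^+ 2).
  by field; rewrite !gt_eqF.
by rewrite divr_ge0 ?addr_ge0 ?mulr_ge0 ?exprn_ge0//; lra.
Qed.

(** The smallest point has no predecessor to telescope against, so it is bounded separately by
    [1/l^2]. *)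
Lemma spaced_sum_inv_sqr_le c l s : uniq s -> 0 < c -> 0 < l ->
  spaced c s -> {in s, forall y, l <= y} ->
  \sum_(y <- s) (y ^+ 2)^-1 <= (l ^+ 2)^-1 + (c * l)^-1.
Proof.
move=> us c0 l0 /(spaced_sort us) ps ls.
rewrite -(perm_big _ (permEl (perm_sort <=%R s))) /=.
have : {in sort <=%R s, forall y, l <= y}.
  by move=> y; rewrite mem_sort; exact: ls.
case: (sort _ s) ps => [|x t] ps {}ls.
  by rewrite big_nil addr_ge0 ?invr_ge0 ?mulr_ge0 ?exprn_ge0// ltW.
have lx := ls x (mem_head _ _); have x0 := lt_le_trans l0 lx.
rewrite big_cons lerD//.
  by rewrite lef_pV2 ?posrE ?exprn_gt0// lerXn2r ?nnegrE// ltW.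
apply: le_trans (pairwise_sum_inv_sqr_le c0 x0 ps) _.
by rewrite lef_pV2 ?posrE ?mulr_gt0// ler_pM2l.
Qed.

(* The points of [- l, N + l] are counted, each with weight at most 1; the
   others contribute through the quadratic decay of S away from [0, N]. *)
Lemma spaced_sum_le c l N s (S : F -> F) : uniq s -> 0 < c -> 0 < l ->
  0 <= N -> spaced c s -> (forall x, S x <= 1) ->
  (forall x, 0 < x -> S (N + x) <= N * (x ^+ 2)^-1) ->
  (forall x, 0 < x -> S (- x) <= N * (x ^+ 2)^-1) ->
  \sum_(x <- s) S x <=
    (N + 2 * l + c) / c + 2 * (N * ((l ^+ 2)^-1 + (c * l)^-1)).
Proof.
move=> us c0 l0 N0 sep S1 SN S0.
rewrite (bigID (fun x => - l <= x <= N + l)) /= lerD//.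
  rewrite -big_filter.
  apply: (@le_trans _ _ (\sum_(x <- [seq x <- s | - l <= x <= N + l]) 1)).
    exact: ler_sum.
  rewrite big_const_seq count_predT iter_addr_0 ler_pdivlMr// mulrC.
  apply: (@le_trans _ _ (N + l - - l + c)); last by lra.
  apply: spaced_size_le; [exact: filter_uniq|lra|lra| |].
    exact: spaced_filter.
  by move=> y; rewrite mem_filter => /andP[].
(* Points left of [- l] are reflected and points right of [N + l] are translated by [- N]; both
   become separated lists bounded below by [l]. *)
rewrite (bigID (fun x => x < - l)) /= mulr_natl mulr2n lerD//.
- rewrite -big_filter.
  set t := [seq _ <- _ | _].
  have tE x : x \in t -> x \in s /\ x < - l.
    by rewrite mem_filter => /andP[/andP[]].
  apply: (@le_trans _ _ (\sum_(y <- map -%R t) N * (y ^+ 2)^-1)).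
    rewrite big_map big_seq [leRHS]big_seq; apply: ler_sum => x /tE[_ xl].
    by rewrite -[in S x](opprK x); apply: S0; lra.
  rewrite -mulr_sumr ler_wpM2l//; apply: spaced_sum_inv_sqr_le => //.
  + by rewrite map_inj_uniq ?filter_uniq//; exact: oppr_inj.
  + exact/spaced_opp/spaced_filter.
  + by move=> _ /mapP[x /tE[_ xl] ->]; lra.
- rewrite -big_filter.
  set t := [seq _ <- _ | _].
  have tE x : x \in t -> N + l < x.
    rewrite mem_filter negb_and -leNgt -!ltNge.
    by move=> /andP[/andP[/orP[]]]; lra.
  apply: (@le_trans _ _ (\sum_(y <- map (fun x => x - N) t) N * (y ^+ 2)^-1)).
    rewrite big_map big_seq [leRHS]big_seq; apply: ler_sum => x /tE xl.
    by rewrite -[in S x](subrKC N x); apply: SN; lra.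
  rewrite -mulr_sumr ler_wpM2l//; apply: spaced_sum_inv_sqr_le => //.
  + by rewrite map_inj_uniq ?filter_uniq//; exact: addIr.
  + move=> _ _ /mapP[x xt ->] /mapP[y yt ->] xy.
    rewrite (_ : _ - _ = x - y); last by ring.
    by apply: (spaced_filter sep xt yt); apply: contraNneq xy => ->.
  + by move=> _ /mapP[x /tE xl ->]; lra.
Qed.
End Spaced.

(** * The squared sinc function and its Bessel inequality *)

Section Sinc.
Context {R : realType}.
Implicit Types t x : R.

Lemma sin_le_id x : 0 <= x -> sin x <= x.
Proof.
rewrite le_eqVlt => /predU1P[<-|x0]; first by rewrite sin0.
have [|c] := @MVT R sin cos 0 x x0 (fun y _ => is_derive_sin y).
  by apply: continuous_subspaceT => y; exact: continuous_sin.
by rewrite sin0 !subr0 => _ ->; rewrite ler_piMl ?cos_le1// ltW.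
Qed.

Lemma sqr_sin_le x : sin x ^+ 2 <= x ^+ 2.
Proof.
wlog x0 : x / 0 <= x.
  move=> H; have [/H//|/ltW x0] := leP 0 x.
  by have := H (- x); rewrite sinN !sqrrN oppr_ge0; exact.
rewrite -(real_normK (num_real (sin x))) lerXn2r ?nnegrE//.
rewrite ler_norml sin_le_id// andbT.
(* For [- x <= sin x]: if [x >= 1], use [-1 <= sin x]; otherwise [x <= pi] and [sin x] is
   nonnegative. *)
have [x1|/ltW x1] := leP 1 x; first by have := sin_geN1 x; lra.
apply: le_trans (_ : 0 <= _); first by lra.
by apply: sin_ge0_pi; have := @pi_ge2 R; lra.
Qed.

(** The normalised sinc, squared. The value at 0 is its limit; the quotient itself would evaluate to
    0 there. *)
Definition sinc2 t : R := if t == 0 then 1 else (sin (pi * t) / (pi * t)) ^+ 2.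

Lemma sinc2_ge0 t : 0 <= sinc2 t.
Proof. by rewrite /sinc2; case: ifP; rewrite ?sqr_ge0. Qed.

Lemma sinc2_le1 t : sinc2 t <= 1.
Proof.
rewrite /sinc2; case: eqVneq => // t0.
rewrite exprMn exprVn ler_pdivrMr ?mul1r ?sqr_sin_le//.
by rewrite exprn_even_gt0//= mulf_neq0// gt_eqF ?pi_gt0.
Qed.

Lemma sinc2_le_inv_sqr t : t != 0 -> sinc2 t <= (t ^+ 2)^-1.
Proof.
move=> t0; rewrite /sinc2 (negPf t0) !exprMn exprVn exprMn invfM mulrA.
rewrite ler_piMl ?invr_ge0 ?sqr_ge0//.
rewrite ler_pdivrMr ?exprn_gt0 ?pi_gt0// mul1r.
apply: (@le_trans _ _ 1); first by rewrite sin2cos2 lerBlDl lerDr sqr_ge0.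
by rewrite expr_ge1 ?pi_ge0//; have := @pi_ge2 R; lra.
Qed.

(** This is [sin (2 u) = 2 sin u cos u] at [u = pi t / 2]. *)
Lemma sinc2_half t : sinc2 t = sinc2 (t / 2) * cos (pi * (t / 2)) ^+ 2.
Proof.
have [->|t0] := eqVneq t 0.
  by rewrite mul0r /sinc2 eqxx mulr0 cos0 expr1n mulr1.
rewrite /sinc2 (negPf t0) mulf_eq0 (negPf t0) invr_eq0 pnatr_eq0/=.
have {1}-> : pi * t = pi * (t / 2) *+ 2 by rewrite mulr2n; field.
rewrite sin_mulr2n; have := pi_gt0 R; move: (pi : R) => p /gt_eqF/negbT p0.
by field; rewrite t0.
Qed.

Lemma sqr_cosDnpi x k : cos (x + pi * k%:R) ^+ 2 = cos x ^+ 2.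
Proof.
elim: k => [|k IHk]; first by rewrite mulr0 addr0.
by rewrite -natr1 mulrDr mulr1 addrA cosDpi sqrrN.
Qed.

Lemma sum_double (f : nat -> R) n :
  \sum_(k < n.*2) f k = \sum_(k < n) f k.*2 + \sum_(k < n) f k.*2.+1.
Proof.
elim: n => [|n IHn]; first by rewrite !big_ord0 addr0.
by rewrite doubleS !big_ord_recr /= IHn; ring.
Qed.

(* A dyadic proof of Bessel's inequality for the exponentials: the even and the
   odd terms are sums for t/2 and (t+1)/2, with weights cos^2 and sin^2. *)
Lemma sum_sinc2_le1 n t : \sum_(k < 2 ^ n) sinc2 (t + k%:R) <= 1.
Proof.
elim: n t => [|n IHn] t.
  by rewrite expn0 big_ord1 sinc2_le1.
have half u : \sum_(k < 2 ^ n) sinc2 (u + k.*2%:R) <= cos (pi * (u / 2)) ^+ 2.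
  rewrite (eq_bigr (fun k : 'I__ =>
      sinc2 (u / 2 + k%:R) * cos (pi * (u / 2)) ^+ 2)) => [|k _].
    by rewrite -mulr_suml ler_piMl ?sqr_ge0.
  have uk : (u + k.*2%:R) / 2 = u / 2 + k%:R :> R.
    by rewrite -muln2 natrM mulrDl mulfK.
  by rewrite sinc2_half uk mulrDr sqr_cosDnpi.
rewrite expnS mul2n (sum_double (fun k => sinc2 (t + k%:R))).
(* The odd terms for [t] are the even terms for [t + 1]. *)
under [X in _ + X]eq_bigr do rewrite -nat1r addrA.
apply: le_trans (lerD (half t) (half (t + 1))) _.
have -> : pi * ((t + 1) / 2) = pi * (t / 2) + pi / 2 :> R.
  by rewrite [(t + 1) / 2]mulrDl mul1r mulrDr.
by rewrite cosDpihalf sqrrN cos2Dsin2.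
Qed.
End Sinc.

(** * Exponentials on the unit interval and their Fourier transforms *)

Section Exponentials.
Context {R : realType}.
Implicit Types (t x : R).
Notation mu := (@lebesgue_measure R).

Lemma Rintegral01 (f F : R -> R) : continuous f ->
  (forall x, is_derive x 1 F (f x)) ->
  Rintegral mu `[0, 1] f = F 1 - F 0.
Proof.
move=> cf dF.
have cF : continuous F.
  move=> x; apply: differentiable_continuous; apply/derivable1_diffP.
  by have [] := dF x.
rewrite /Rintegral (@continuous_FTC2 _ f F) ?ltr01//.
- exact: continuous_subspaceT.
- split; first by move=> x _; have [] := dF x.
    exact/cvg_at_right_filter/cF.
  exact/cvg_at_left_filter/cF.
- by move=> x _; rewrite derive1E; apply: derive_val.
Qed.

Lemma continuous_cos_mull t : continuous (fun x => cos (t * x)).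
Proof.
move=> x; apply: continuous_comp; last exact: continuous_cos.
exact: mulrl_continuous.
Qed.

Lemma continuous_sin_mull t : continuous (fun x => sin (t * x)).
Proof.
move=> x; apply: continuous_comp; last exact: continuous_sin.
exact: mulrl_continuous.
Qed.

Lemma Rintegral01_cos t : t != 0 ->
  Rintegral mu `[0, 1] (fun x => cos (t * x)) = sin t / t.
Proof.
move=> t0.
have dF x : is_derive x 1 (fun x => t^-1 * sin (t * x)) (cos (t * x)).
  apply: is_derive_eq.
  by rewrite /GRing.scale/=; field.
rewrite (Rintegral01 (@continuous_cos_mull t) dF).
by rewrite mulr0 sin0 mulr0 subr0 mulr1 mulrC.
Qed.

Lemma Rintegral01_sin t : t != 0 ->
  Rintegral mu `[0, 1] (fun x => sin (t * x)) = (1 - cos t) / t.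
Proof.
move=> t0.
have dF x : is_derive x 1 (fun x => - t^-1 * cos (t * x)) (sin (t * x)).
  apply: is_derive_eq.
  by rewrite /GRing.scale/=; field.
rewrite (Rintegral01 (@continuous_sin_mull t) dF).
by rewrite mulr0 cos0 !mulr1; field.
Qed.

Definition wave (l x : R) : R[i] := cexp ((2 * pi * l * x) *i)%C.

Lemma waveE l x :
  wave l x = (cos (2 * pi * l * x) +i* sin (2 * pi * l * x))%C.
Proof.
by rewrite /wave /cexp/= expR0 mul1r.
Qed.

Lemma normc_wave l x : Normc.normc (wave l x) ^+ 2 = 1.
Proof. by rewrite waveE /= cos2Dsin2 sqrtr1 expr1n. Qed.

Lemma sqnorm01_wave l : sqnorm01 (wave l) = 1%E.
Proof.
rewrite /sqnorm01; under eq_integral do rewrite normc_wave.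
rewrite integral_cst//= mul1e lebesgue_measure_itv/= lte_fin ltr01.
by rewrite -EFinB subr0.
Qed.

Lemma wave_inL2 l : inL2_01 (wave l).
Proof.
split; last by rewrite sqnorm01_wave ltry.
- rewrite (_ : (fun x => _) = (fun x => cos (2 * pi * l * x))); last first.
    by apply/funext => x; rewrite waveE.
  apply: measurable_funTS; apply: continuous_measurable_fun.
  exact: continuous_cos_mull.
- rewrite (_ : (fun x => _) = (fun x => sin (2 * pi * l * x))); last first.
    by apply/funext => x; rewrite waveE.
  apply: measurable_funTS; apply: continuous_measurable_fun.
  exact: continuous_sin_mull.
Qed.

(** For [t = m - l] nonzero and [u = pi t], the transform has real part [sin (2 u) / (2 u)] and
    imaginary part [(1 - cos (2 u)) / (2 u)]; double angles reduce the sum of squares to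
    [(sin u / u)^2]. *)
Lemma normc_fourier01_wave m l :
  Normc.normc (fourier01 (wave m) l) ^+ 2 = sinc2 (m - l).
Proof.
rewrite /fourier01 /cint01.
have E x : wave m x * cexp ((- (2 * pi * l * x)) *i)%C = wave (m - l) x.
  rewrite !waveE /cexp/= expR0 mul1r cosN sinN.
  have -> : 2 * pi * (m - l) * x = 2 * pi * m * x - 2 * pi * l * x by ring.
  rewrite cosB sinB; apply/eqP; rewrite eq_complex/=; apply/andP; split.
    by apply/eqP; ring.
  by apply/eqP; ring.
under eq_Rintegral do rewrite E waveE/=.
under [X in (_ +i* X)%C]eq_Rintegral do rewrite E waveE/=.
rewrite /= sqr_sqrtr ?addr_ge0 ?sqr_ge0//.
have [->|t0] := eqVneq m l.
  rewrite subrr /sinc2 eqxx.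
  under eq_Rintegral do rewrite mulr0 mul0r cos0.
  under [X in _ + X ^+ 2]eq_Rintegral do rewrite mulr0 mul0r sin0.
  by rewrite !Rintegral_cst//= lebesgue_measure_itv/= lte_fin ltr01
    -EFinB subr0/= mul0r mulr1 expr0n addr0 expr1n.
move: t0; rewrite -subr_eq0; set t := m - l => t0.
have p0 : pi != 0 :> R by rewrite gt_eqF ?pi_gt0.
have pt0 : 2 * pi * t != 0 by rewrite !mulf_neq0.
rewrite Rintegral01_cos// Rintegral01_sin// /sinc2 (negPf t0).
have -> : 2 * pi * t = (pi * t) *+ 2 by rewrite mulr2n; ring.
have : pi * t != 0 by rewrite mulf_neq0.
move: (pi * t) => u u0.
rewrite cos_mulr2n sin_mulr2n.
have := cos2Dsin2 u; move: (cos u) (sin u) => c s /(canRL (addrK _)) cs.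
rewrite (_ : c ^+ 2 *+ 2 - 1 = 1 - 2 * s ^+ 2); last by rewrite cs; ring.
transitivity (((s ^+ 2) * (c ^+ 2 + s ^+ 2)) / u ^+ 2).
  by field.
by rewrite cs subrK mulr1 exprMn exprVn.
Qed.
End Exponentials.

(** * Comparing the two bounds for the summed sinc *)

Section FrameBound.
Context {R : realType}.
Implicit Types (x : R) (lam : int -> R).

(** The sum [S] with [N = 2 ^ n], a power of two because Bessel's inequality is proved
    dyadically. *)
Definition sinc2_sum (n : nat) (x : R) := \sum_(k < 2 ^ n) sinc2 (k%:R - x).

Lemma sinc2_sum_le1 n x : sinc2_sum n x <= 1.
Proof.
rewrite /sinc2_sum; under eq_bigr do rewrite addrC.
exact: sum_sinc2_le1.
Qed.

Lemma sinc2_sum_le n x y : 0 < y ->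
  (forall k : nat, (k < 2 ^ n)%N -> y <= `|k%:R - x|) ->
  sinc2_sum n x <= 2 ^+ n * (y ^+ 2)^-1.
Proof.
move=> y0 yx; rewrite -natrX -[X in X%:R]card_ord mulr_natl -sumr_const.
apply: ler_sum => k _; have yk := yx k (ltn_ord k).
have kx0 : k%:R - x != 0 by rewrite -normr_gt0; exact: lt_le_trans yk.
apply: le_trans (sinc2_le_inv_sqr kx0) _.
have y2 : 0 < y ^+ 2 by rewrite exprn_gt0.
have yk2 : y ^+ 2 <= (k%:R - x) ^+ 2.
  by rewrite -(real_normK (num_real (_ - x))) lerXn2r// nnegrE ltW.
by rewrite lef_pV2 ?posrE// (lt_le_trans y2).
Qed.

Lemma sinc2_sum_right n x : 0 < x ->
  sinc2_sum n (2 ^+ n + x) <= 2 ^+ n * (x ^+ 2)^-1.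
Proof.
move=> x0; apply: sinc2_sum_le => // k kn.
have : k%:R <= 2 ^+ n :> R by rewrite -natrX ler_nat ltnW.
by move=> kN; rewrite distrC ger0_norm; lra.
Qed.

Lemma sinc2_sum_left n x : 0 < x ->
  sinc2_sum n (- x) <= 2 ^+ n * (x ^+ 2)^-1.
Proof.
move=> x0; apply: sinc2_sum_le => // k kn.
have : 0 <= k%:R :> R by [].
by move=> k0; rewrite ger0_norm; lra.
Qed.

Lemma gap_le_sub lam k l : {homo lam : n m / n < m} -> k < l ->
  gap lam l <= lam l - lam k.
Proof.
move=> homo kl; rewrite /gap lerD2l lerN2.
by apply: (ltW_homo homo); rewrite lerBrDr lezD1.
Qed.

(** Two points differ by at least the gap just below the larger one, so discarding the points above
    short gaps leaves a separated set. *)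
Lemma spaced_large_gaps lam c (s : seq R) : {homo lam : n m / n < m} ->
  (forall x, x \in s -> exists2 k, lam k = x & c <= gap lam k) ->
  spaced c s.
Proof.
move=> homo sE x y /sE[k <- gk] /sE[l <- gl].
have [kl _|lk _|->] := ltgtP k l; last by rewrite eqxx.
  rewrite distrC gtr0_norm ?subr_gt0 ?homo//.
  exact: le_trans gl (gap_le_sub homo kl).
rewrite gtr0_norm ?subr_gt0 ?homo//.
exact: le_trans gk (gap_le_sub homo lk).
Qed.

Lemma esum_sinc2_sum_le lam (L : set R) c n (l : R) : 0 < c -> 0 < l ->
  increasing_enumeration lam L -> finite_set [set k | gap lam k < c] ->
  (\esum_(x in L) (sinc2_sum n x)%:E <=
    (#|` fset_set (lam @` [set k | gap lam k < c])|%:R +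
      ((2 ^+ n + 2 * l + c) / c +
        2 * (2 ^+ n * ((l ^+ 2)^-1 + (c * l)^-1))))%:E)%E.
Proof.
move=> c0 l0 [homo lamL] finE; set E := lam @` _.
have fE : finite_set E by exact: finite_image.
(* The sum is a supremum over finite subsets [X]. Points of [X] in [E] cost at most 1 each; the
   others are separated. *)
apply: ge_ereal_sup => _ [X [fX XL] <-].
rewrite fsbig_finite//= sumEFin lee_fin (bigID (fun x => x \in E)) /= lerD//.
  rewrite -big_filter; apply: (@le_trans _ _
      (\sum_(x <- [seq x <- fset_set X | x \in E]) 1)).
    by apply: ler_sum => x _; exact: sinc2_sum_le1.
  rewrite big_const_seq count_predT iter_addr_0 ler_nat.
  apply: uniq_leq_size; first by rewrite filter_uniq ?fset_uniq.
  by move=> x; rewrite mem_filter !in_fset_set// => /andP[].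
rewrite -big_filter; apply: spaced_sum_le => //.
- by rewrite filter_uniq ?fset_uniq.
- apply: spaced_large_gaps homo _ => x.
  rewrite mem_filter in_fset_set// => /andP[/negP xE /set_mem /XL].
  rewrite -lamL => -[k _ kx]; exists k => //; rewrite leNgt; apply/negP => gk.
  by apply: xE; apply/mem_set; exists k.
- exact: sinc2_sum_le1.
- exact: sinc2_sum_right.
- exact: sinc2_sum_left.
Qed.

(** The frame inequalities of [2 ^ n] exponentials of norm 1 are added; nonnegativity lets the sums
    be exchanged. *)
Lemma frame_sinc2_sum_ge (L : set R) (A : R) n :
  (forall f : R -> R[i], inL2_01 f -> (A%:E * sqnorm01 f <=
    \esum_(l in L) ((Normc.normc (fourier01 f l)) ^+ 2)%:E)%E) ->
  ((2 ^+ n * A)%:E <= \esum_(x in L) (sinc2_sum n x)%:E)%E.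
Proof.
move=> frame; under eq_esum do rewrite /sinc2_sum -sumEFin.
rewrite esum_sum => [|x k _ _]; last by rewrite lee_fin sinc2_ge0.
rewrite -natrX -[X in X%:R]card_ord mulr_natl -sumr_const -sumEFin.
apply: lee_sum => k _; have := frame _ (wave_inL2 k%:R).
rewrite sqnorm01_wave mule1 => /le_trans; apply.
by apply: le_esum => x _; rewrite normc_fourier01_wave.
Qed.

Lemma quadratic_bound_le (d a b : R) :
  (forall p, d * (2 ^+ p) ^+ 2 <= a + b * 2 ^+ p) -> d <= 0.
Proof.
move=> H; rewrite leNgt; apply/negP => d0.
pose p := Num.bound ((`|a| + `|b|) / d).
have pX : (`|a| + `|b|) / d < 2 ^+ p.
  apply: lt_trans (archi_boundP _) _.
    by rewrite divr_ge0 ?addr_ge0// ltW.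
  by rewrite -natrX ltr_nat ltn_expl.
rewrite ltr_pdivrMr// in pX.
have := H p; rewrite leNgt => /negP; apply.
(* This absorbs the constant term: the right side is at most [(|a| + |b|) 2^p], which the choice of
   [p] puts below [d (2^p)^2]. *)
have X1 : 1 <= 2 ^+ p :> R by rewrite exprn_ege1// ler1n.
apply: (@le_lt_trans _ _ ((`|a| + `|b|) * 2 ^+ p)).
  rewrite mulrDl lerD//; last by rewrite ler_wpM2r ?ler_norm// exprn_ge0.
  by apply: le_trans (ler_norm a) _; rewrite ler_peMr.
by rewrite expr2 mulrA [d * _]mulrC ltr_pM2r// exprn_gt0.
Qed.

Lemma frame_bound_le lam (L : set R) (A c : R) : 0 < c ->
  increasing_enumeration lam L -> finite_set [set k | gap lam k < c] ->
  (forall f : R -> R[i], inL2_01 f -> (A%:E * sqnorm01 f <=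
    \esum_(l in L) ((Normc.normc (fourier01 f l)) ^+ 2)%:E)%E) ->
  A <= c^-1.
Proof.
move=> c0 enum finE frame; rewrite -subr_le0.
set K : R := #|` fset_set (lam @` [set k | gap lam k < c])|%:R.
(* With [l = 2^p] and [N = l^2] the upper bound expands to [l^2 / c + (K + 3) + (4 / c) l]. *)
apply: (@quadratic_bound_le _ (K + 3) (4 / c)) => p.
have p0 : 0 < 2 ^+ p :> R by rewrite exprn_gt0.
have := le_trans (frame_sinc2_sum_ge (p * 2)%N frame)
  (esum_sinc2_sum_le (p * 2)%N c0 p0 enum finE).
rewrite lee_fin -/K exprM; move: (2 ^+ p) p0 => l l0.
have -> : K + ((l ^+ 2 + 2 * l + c) / c +
    2 * (l ^+ 2 * ((l ^+ 2)^-1 + (c * l)^-1))) =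
    l ^+ 2 * c^-1 + (K + 3 + 4 / c * l).
  by field; rewrite !gt_eqF.
by rewrite mulrBl ![_ * l ^+ 2]mulrC; lra.
Qed.

Lemma gmin_le lam (L : set R) (A : R) : 0 < A ->
  increasing_enumeration lam L ->
  (forall f : R -> R[i], inL2_01 f -> (A%:E * sqnorm01 f <=
    \esum_(l in L) ((Normc.normc (fourier01 f l)) ^+ 2)%:E)%E) ->
  (gmin lam <= (A^-1)%:E)%E.
Proof.
move=> A0 enum frame; apply/lee_addgt0Pr => e e0.
have Ai0 : 0 < A^-1 by rewrite invr_gt0.
have c0 : 0 < A^-1 + e by rewrite addr_gt0.
rewrite -EFinD.
(* Finitely many such gaps would force [A^-1 + e <= A^-1]; hence [A^-1 + e] belongs to the set whose
   infimum is taken. *)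
have [finE|infE] := pselect (finite_set [set k | gap lam k < A^-1 + e]).
  have := frame_bound_le c0 enum finE frame.
  rewrite -lef_pV2 ?posrE ?invr_gt0// invrK => ?; exfalso; lra.
by apply: ereal_inf_lbound; exists (A^-1 + e) => //; split => //; exact: ltW.
Qed.
End FrameBound.

Local Open Scope ereal_scope.

Theorem corollary1p4 (R : realType) (Lambda : R -> set R) (lam : R -> int -> R)
  (hlam : forall A : R, (0 < A)%R ->
    increasing_enumeration (lam A) (Lambda A))
  (hframe : forall A : R, (0 < A)%R -> forall f : R -> R[i], inL2_01 f ->
    A%:E * sqnorm01 f <=
    \esum_(l in Lambda A) ((Normc.normc (fourier01 f l)) ^+ 2)%:E) :
  limf_esup (fun A : R => A%:E * gmin (lam A)) (pinfty_nbhs R) <= 1.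
Proof.
(* The upper limit is at most the supremum over the neighbourhood [A > 0] of infinity, where the
   bound holds pointwise. *)
apply: ge_ereal_inf; eexists.
  by exists [set A : R | (0 < A)%R] => //; exists 0%R; split.
apply: ge_ereal_sup => _ [A A0 <-].
have := gmin_le A0 (hlam A A0) (hframe A A0).
move/(lee_wpmul2l (ltW A0 : 0 <= A%:E)) => /le_trans; apply.
by rewrite -EFinM mulfV// gt_eqF.
Qed.
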